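(* Let $\{\mathcal{Q}_n\}_{n\ge0}$ be a fine grid in $S^1$ with fine grid constants $a,\rho$, let $\lambda>0$, and let $h:S^1\to S^1$ be a homeomorphism such that $$\left|\frac{|\Delta'|}{|\Delta''|}-\frac{|h(\Delta')|}{|h(\Delta'')|}\right|\le\lambda$$ for each pair of adjacent atoms $\Delta',\Delta''\in\mathcal{Q}_n$, for all $n\ge0$. Then there exists $K=K(a,\rho,\lambda)>1$ (depending only on $a,\rho,\lambda$) such that $h$ is $K$-quasisymmetric.
   Context: $S^1=\mathbb{R}/\mathbb{Z}$; $|I|$ is the length of an interval $I\subset S^1$. Partitions of $S^1$ are finite partitions into closed intervals (atoms) modulo endpoints; two atoms are adjacent if they share an endpoint. A fine grid is a sequence $\{\mathcal{Q}_n\}_{n\ge0}$ of finite partitions of $S^1$, with $\mathcal{Q}_0$ the trivial partition $\{S^1\}$, such that: (a) each $\mathcal{Q}_{n+1}$ is a strict refinement of $\mathcal{Q}_n$ (every atom of $\mathcal{Q}_n$ is the union of at least two atoms of $\mathcal{Q}_{n+1}$); (b) there is an integer $a\ge2$ such that each atom $\Delta\in\mathcal{Q}_n$ is the (disjoint, modulo endpoints) union of at most $a$ atoms of $\mathcal{Q}_{n+1}$; (c) there is $\rho>1$ such that $\rho^{-1}|\Delta|\le|\Delta'|\le\rho|\Delta|$ for each pair of adjacent atoms $\Delta,\Delta'\in\mathcal{Q}_n$. The numbers $a,\rho$ are called fine grid constants. A homeomorphism $h:S^1\to S^1$ is $K$-quasisymmetric ($K\ge1$) if for all $x\in S^1$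 and all $t>0$, $\frac1K\le\frac{|h(x+t)-h(x)|}{|h(x)-h(x-t)|}\le K$, where the differences are computed with a lift of $h$ to $\mathbb{R}$. *)

(* Defs.v *)
From HB Require Import structures.
From mathcomp Require Import all_boot all_order all_algebra generic_quotient.
From mathcomp Require Import all_classical all_reals all_analysis.
From mathcomp Require Import lra.

Set Implicit Arguments.
Unset Strict Implicit.
Unset Printing Implicit Defensive.

Import Order.TTheory GRing.Theory Num.Theory.
Import numFieldNormedType.Exports.

Local Open Scope classical_set_scope.
Local Open Scope card_scope.
Local Open Scope ring_scope.
Local Open Scope quotient_scope.

Section circle.
Context (R : realType).

Let eqmodZ (x y : R) : bool := x - y \is a Num.int.

Local Lemma eqmodZ_refl : reflexive eqmodZ.
Proof. by move=> x; rewrite /eqmodZ subrr rpred0. Qed.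

Local Lemma eqmodZ_sym : symmetric eqmodZ.
Proof. by move=> x y; rewrite /eqmodZ -opprB rpredN. Qed.

Local Lemma eqmodZ_trans : transitive eqmodZ.
Proof.
by move=> y x z xy yz; rewrite /eqmodZ -(subrKA y) rpredD.
Qed.

Definition circle_rel := EquivRel _ eqmodZ_refl eqmodZ_sym eqmodZ_trans.

(* R/Z with the quotient topology *)
Definition circle := {eq_quot circle_rel}.
HB.instance Definition _ := Topological.copy circle (quotient_topology circle).
HB.instance Definition _ := Quotient.on circle.

Definition circle_pi (x : R) : circle := \pi_circle x.

Lemma circle_piP (x y : R) :
  circle_pi x = circle_pi y <-> x - y \is a Num.int.
Proof. by split=> [/eqmodP|?]; [|apply/eqmodP]. Qed.

Lemma circle_pi_continuous : continuous circle_pi.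
Proof. exact: pi_continuous. Qed.

End circle.

Section intervals.
Context (R : realType).
Implicit Types (x y l : R) (A B I : set (circle R)) (p : circle R).

(* [A] is the closed interval of the circle running from [x] to [y]; the case
   [y = x + 1] is the whole circle, regarded as an interval cut at [x]. *)
Definition interval_from_to A x y : Prop :=
  x < y <= x + 1 /\ A = @circle_pi R @` `[x, y].

Definition closed_interval A : Prop := exists x y, interval_from_to A x y.

Definition endpoint A p : Prop :=
  exists x y, interval_from_to A x y /\ (p = circle_pi x \/ p = circle_pi y).

(* [|A|]; this is well defined by [interval_lengthE] below *)
Definition interval_length A : R :=
  xget 0 [set l | exists x y, interval_from_to A x y /\ l = y - x].

Definition adjacent_intervals A B : Prop :=
  A <> B /\ exists p, endpoint A p /\ endpoint B p.

End intervals.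

Section length_well_defined.
Context (R : realType).
Implicit Types (x y z : R) (A : set (circle R)).

Lemma interval_from_to_shift A x y z : interval_from_to A x y ->
  z \is a Num.int -> interval_from_to A (x + z) (y + z).
Proof.
move=> [/andP[xy yx1] ->] zZ; split; first by apply/andP; split; lra.
apply/seteqP; split => _ [u /= + <-]; rewrite in_itv /= => /andP[u1 u2].
- exists (u + z); first by rewrite /= in_itv /=; apply/andP; split; lra.
  by apply/circle_piP; rewrite addrAC subrr add0r.
- exists (u - z); first by rewrite /= in_itv /=; apply/andP; split; lra.
  by apply/circle_piP; rewrite addrAC subrr add0r rpredN.
Qed.

Let length_le A x y x' y' :
  interval_from_to A x y -> interval_from_to A x' y' -> y' - x' <= y - x.
Proof.
move=> Axy Ax'y'; rewrite leNgt; apply/negP => lt_len.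
have [/andP[xy yx1] AE] := Axy.
have [/andP[x'y' y'x1'] A'E] := Ax'y'.
have : A (circle_pi x').
  by rewrite A'E; exists x' => //=; rewrite in_itv /= lexx ltW.
rewrite {1}AE => -[u /= + /circle_piP uxZ]; rewrite in_itv /= => /andP[xu uy].
have := interval_from_to_shift Ax'y' uxZ; rewrite (addrC x') subrK.
set v := y' + _ => -[/andP[uv vu1] AE'].
have vE : v - u = y' - x' by rewrite /v; lra.
pose m := Num.min v (x + 1).
have my : y < m by rewrite /m lt_min; apply/andP; split; lra.
have mv : m <= v by rewrite /m ge_min lexx.
have mx : m <= x + 1 by rewrite /m ge_min lexx orbT.
pose w := (y + m) / 2.
have yw : y < w by rewrite /w; lra.
have wm : w < m by rewrite /w; lra.
have : A (circle_pi w).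
  rewrite AE'; exists w => //=; rewrite in_itv /=; apply/andP; split; lra.
rewrite AE => -[s /= + /circle_piP]; rewrite in_itv /= => /andP[xs sy].
move=> /intrP[k swk].
have : (k%:~R : R) < 0 by rewrite -swk; lra.
have : - 1 < (k%:~R : R) by rewrite -swk; lra.
rewrite -[- 1]/((- 1)%:~R) -[0]/(0%:~R) !ltr_int.
by case: k {swk} => [[|?]|[|?]].
Qed.

Lemma interval_lengthE A x y :
  interval_from_to A x y -> interval_length A = y - x.
Proof.
move=> Axy; rewrite /interval_length; apply: xget_unique.
  by exists x, y.
move=> _ [x' [y' [Ax'y' ->]]].
by apply/eqP; rewrite eq_le (length_le Axy Ax'y') (length_le Ax'y' Axy).
Qed.

End length_well_defined.

Section fine_grid.
Context (R : realType).
Implicit Types (P Q : set (set (circle R))) (A B : set (circle R)).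

Definition circle_partition P : Prop :=
  [/\ finite_set P,
      forall A, P A -> closed_interval A,
      \bigcup_(A in P) A = [set: circle R]
    & forall A B, P A -> P B -> A <> B ->
        A `&` B `<=` @endpoint R A `&` @endpoint R B].

Definition strict_refinement P Q : Prop :=
  forall A, P A -> exists F : set (set (circle R)),
    [/\ F `<=` Q, A = \bigcup_(B in F) B & `I_2 #<= F].

Definition fine_grid (a : nat) (rho : R) (Q : nat -> set (set (circle R))) :
    Prop :=
  [/\ (forall n, circle_partition (Q n)) /\ Q 0%N = [set setT],
      forall n, strict_refinement (Q n) (Q n.+1),
      (2 <= a)%N /\
      forall n A, Q n A -> exists F : set (set (circle R)),
        [/\ F `<=` Q n.+1, A = \bigcup_(B in F) B & F #<= `I_a]
    & 1 < rho /\
      forall n A B, Q n A -> Q n B -> adjacent_intervals A B ->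
        rho^-1 * interval_length A <= interval_length B
          <= rho * interval_length A].

End fine_grid.

Section quasisymmetric.
Context (R : realType).
Implicit Types (h : circle R -> circle R) (H : R -> R).

Definition circle_homeomorphism h : Prop :=
  exists g : circle R -> circle R,
    [/\ cancel h g, cancel g h, continuous h & continuous g].

Definition is_lift h H : Prop :=
  continuous H /\ forall x, circle_pi (H x) = h (circle_pi x).

(* Lifts of [h] differ by integer constants, so the choice of [H] is
   immaterial. *)
Definition quasisymmetric (K : R) h : Prop :=
  1 <= K /\ exists H, is_lift h H /\
    forall x t : R, 0 < t ->
      K^-1 <= `|H (x + t) - H x| / `|H x - H (x - t)| <= K.

End quasisymmetric.

(* Main.v *)
Require Import Defs.
From mathcomp Require Import all_boot all_order all_algebra.
From mathcomp Require Import all_classical all_reals all_analysis.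
From mathcomp Require Import lra.
Import Order.TTheory GRing.Theory Num.Theory.
Import numFieldNormedType.Exports.
Local Open Scope classical_set_scope.
Local Open Scope card_scope.
Local Open Scope ring_scope.

Set Implicit Arguments.
Unset Strict Implicit.
Unset Printing Implicit Defensive.

(* Lift everything to the real line. The atoms of [Q n] become a [1]-periodic
   tiling, and [h] becomes, up to sign, an increasing map [M] of degree 1. The
   hypothesis gives [|h A| <= (rho + lambda) |h B|] for adjacent atoms, so [M]
   distorts both the passage between neighbours and, a parent having at most
   [a] children, the passage from parent to child by bounded factors only.

   Given a midpoint [m] and a half-width [s], take the first level at which
   some tile containing [m] has length at most [s]; this tile lies in
   [[m - s, m + s]]. Its parent is longer than [s], and each generation
   multiplies lengths by at least [1 + 1/rho], so boundedly many generations up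
   there is a tile which, together with its two neighbours, covers
   [[m - 3 s, m + 3 s]], while its [M]-size is still bounded by a constant times
   that of the original tile. With [m = x -+ t/2] and [s = t/2] this compares
   [M] on [[x - t, x]] and on [[x, x + t]]. *)

(** * Tilings of the line *)

(** Bernoulli's inequality gives [n (q - 1) <= q ^+ n]. It provides both the existence of
    arbitrarily small tiles and the number [k] of generations to climb. *)
Lemma expr_unbounded (R : realType) (q M : R) : 1 < q -> exists n, M <= q ^+ n.
Proof.
move=> q1; have bernoulli n : n%:R * (q - 1) <= q ^+ n.
  elim: n => [|n IH]; first by rewrite mul0r.
  have : 1 <= q ^+ n by rewrite exprn_ege1 // ltW.
  rewrite exprS -natr1 => q1n.
  have : (q - 1) * 1 <= (q - 1) * q ^+ n by rewrite ler_wpM2l //; lra.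
  lra.
exists (Num.truncn (M / (q - 1))).+1; apply: le_trans (bernoulli _).
by rewrite -ler_pdivrMr ?subr_gt0 // ltW // truncnS_gt.
Qed.

Section tiling.
Context (R : realType).
Implicit Types (G : nat -> R -> R -> Prop) (f : R -> R) (x y z s : R).

(** [G n x y] reads: [[x, y]] is a tile of level [n]. The last field bounds the number of children
    without cardinals: no run of [a + 1] consecutive tiles of level [n + 1] fits in a tile of level
    [n]. *)
Record tiling (a : nat) G : Prop := Tiling {
  tile_lt : forall n x y, G n x y -> x < y;
  tile0 : forall x y, G 0%N x y -> y = x + 1;
  tile_cover : forall n m, exists x y, G n x y /\ x <= m <= y;
  tile_right : forall n x y, G n x y -> exists z, G n y z;
  tile_left : forall n x y, G n x y -> exists w, G n w x;
  tile_disjoint : forall n x y u v, G n x y -> G n u v ->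
    x < v -> u < y -> x = u /\ y = v;
  tile_parent : forall n x y, G n.+1 x y -> exists X Y,
    [/\ G n X Y, X <= x, y <= Y & (X < x) || (y < Y)];
  tile_card : forall n X Y (y : nat -> R), G n X Y ->
    (forall i, (i <= a)%N -> G n.+1 (y i) (y i.+1)) ->
    X <= y 0%N -> y a.+1 <= Y -> False }.

(** Used with [f = id] for lengths of tiles, and with the increasing map of the line for lengths of
    their images. *)
Definition comparable_tiles G sigma f := forall n x y z,
  G n x y -> G n y z -> f z - f y <= sigma * (f y - f x) /\
                        f y - f x <= sigma * (f z - f y).

Context (a : nat) (G : nat -> R -> R -> Prop) (tG : tiling a G).

(** The parent of [[x, y]] also overlaps [[X, Y]], so disjointness at level [n] identifies the
    two. *)
Lemma tile_nested n x y X Y : G n.+1 x y -> G n X Y -> x < Y -> X < y ->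
  X <= x /\ y <= Y.
Proof.
move=> Gxy GXY xY Xy.
have [X' [Y' [G' X'x yY' _]]] := tile_parent tG Gxy.
by have [| |-> ->] := tile_disjoint tG GXY G'; [lra..|].
Qed.

Lemma tile_first_child n X Y : G n X Y -> exists z, G n.+1 X z.
Proof.
move=> GXY; have XY := tile_lt tG GXY.
have [u [v [Guv /andP[uX Xv]]]] := tile_cover tG n.+1 X.
have [->|Xv'] := eqVneq X v; first exact: (tile_right tG Guv).
have {Xv'}Xv : X < v by rewrite lt_neqAle Xv'.
have [Xu _] := tile_nested Guv GXY (le_lt_trans uX XY) Xv.
by exists v; have -> : X = u by lra.
Qed.

(** Walk to the right from [X] without stopping at [Y]. If [y a < Y], the tile starting at [y a] is
    still nested in [[X, Y]], which then holds [a + 1] children. *)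
Lemma tile_children n X Y : G n X Y -> exists y : nat -> R,
  [/\ y 0%N = X, Y <= y a & forall i, G n.+1 (y i) (y i.+1)].
Proof.
move=> GXY.
(* [nx] sends the left end of a tile to its right end; at other points its value is arbitrary. *)
have /choice[nx nxP] u : exists v, (exists w, G n.+1 u w) -> G n.+1 u v.
  by have [[w ?]|nw] := pselect (exists w, G n.+1 u w); [exists w|exists 0].
pose y i := iter i nx X.
have Gy i : G n.+1 (y i) (y i.+1).
  by elim: i => [|i /(tile_right tG)] => [|?]; apply: nxP => //;
    apply: tile_first_child GXY.
exists y; split=> //; rewrite leNgt; apply/negP => yaY.
have ymono : {homo y : i j / (i <= j)%N >-> i <= j}.
  apply: homo_leq => // [? ? ?|i]; first exact: le_trans.
  exact: ltW (tile_lt tG (Gy i)).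
apply: (tile_card tG GXY (fun i _ => Gy i)) => //.
have Xya : X < y a.+1.
  by have := ymono 0%N a isT; have := tile_lt tG (Gy a); rewrite /y /=; lra.
by have [] := tile_nested (Gy a) GXY yaY Xya.
Qed.

(** With truncated subtraction the exponent is the distance between [i] and [j]; each step to a
    neighbour costs one factor [sigma]. *)
Lemma comparable_chain sigma f (y : nat -> R) (n i j : nat) :
  1 <= sigma -> {homo f : x y / x <= y} -> comparable_tiles G sigma f ->
  (forall i, G n (y i) (y i.+1)) ->
  f (y i.+1) - f (y i) <= sigma ^+ (i - j + (j - i))%N * (f (y j.+1) - f (y j)).
Proof.
move=> s1 fm cf Gy.
have s0 : 0 <= sigma by lra.
have up k l : f (y (k + l).+1) - f (y (k + l)%N) <=
    sigma ^+ k * (f (y l.+1) - f (y l)).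
  elim: k => [|k IH]; first by rewrite add0n expr0 mul1r.
  rewrite addSn exprS -mulrA; have [+ _] := cf _ _ _ _ (Gy (k + l)%N) (Gy _).
  by move/le_trans; apply; rewrite ler_wpM2l.
have down k l : f (y l.+1) - f (y l) <=
    sigma ^+ k * (f (y (k + l).+1) - f (y (k + l)%N)).
  elim: k => [|k IH]; first by rewrite add0n expr0 mul1r.
  rewrite addSn exprSr -mulrA; have [_ +] := cf _ _ _ _ (Gy (k + l)%N) (Gy _).
  by move=> ?; apply: (le_trans IH); rewrite ler_wpM2l ?exprn_ge0.
have [ij|ji] := leqP i j.
- by have := down (j - i)%N i; rewrite subnK // (eqP ij) add0n.
- by have := up (i - j)%N j; rewrite subnK ?(ltnW ji) // (eqP (ltnW ji)) addn0.
Qed.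

(** The parent is covered by [a] consecutive tiles, each at most [a] steps away from the given
    child. *)
Lemma tile_child_ge sigma f n X Y x y :
  1 <= sigma -> {homo f : x y / x <= y} -> comparable_tiles G sigma f ->
  G n X Y -> G n.+1 x y -> X <= x -> y <= Y ->
  f Y - f X <= a%:R * sigma ^+ a * (f y - f x).
Proof.
move=> s1 fm cf GXY Gxy Xx yY.
have [c [c0 Yc Gc]] := tile_children GXY.
have xy := tile_lt tG Gxy.
(* The given child occurs in the enumeration: [j.+1] is the least index whose point exceeds [x]. *)
have [j ja [cj cj1]] : exists2 j, (j < a)%N & c j = x /\ c j.+1 = y.
  have exc : exists i, x < c i by exists a; lra.
  case: (ex_minnP exc) => -[|j]; first by rewrite c0; lra.
  move=> xcj minj; exists j.
    by have := minj a; rewrite (lt_le_trans _ Yc) ?(lt_le_trans xy) //; exact.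
  have cjx : c j <= x.
    by rewrite leNgt; apply/negP => /minj; rewrite ltnn.
  by apply: (tile_disjoint tG (Gc j) Gxy) => //; lra.
have -> : f x = f (c j) by rewrite cj.
have -> : f y = f (c j.+1) by rewrite cj1.
have : f (c a) - f X <= a%:R * sigma ^+ a * (f (c j.+1) - f (c j)).
  rewrite -c0 -(telescope_sumr (f \o c)) // -mulrA mulr_natl.
  rewrite -[leRHS]/(_ *+ a) -[X in _ *+ X]subn0 -sumr_const_nat.
  rewrite big_nat [leRHS]big_nat; apply: ler_sum => i /andP[_ ia] /=.
  apply: (le_trans (comparable_chain i j s1 fm cf Gc)).
  rewrite ler_wpM2r ?subr_ge0 ?fm ?(ltW (tile_lt tG (Gc _))) //.
  rewrite ler_weXn2l //.
  have [ij|ji] := leqP i j; rewrite ?(eqP ij) ?(eqP (ltnW ji)) ?addn0;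
    by rewrite (leq_trans (leq_subr _ _)) // ltnW.
by have := fm _ _ Yc; lra.
Qed.

(** Strictness of the refinement leaves room for a neighbour of the child inside the same parent,
    and its length is at least [(y - x) / rho]. *)
Lemma tile_child_le rho n X Y x y : 1 < rho -> comparable_tiles G rho id ->
  G n X Y -> G n.+1 x y -> X <= x -> y <= Y ->
  (1 + rho^-1) * (y - x) <= Y - X.
Proof.
move=> r1 cr GXY Gxy Xx yY; have xy := tile_lt tG Gxy.
have r0 : 0 < rho by lra.
have [X' [Y' [G' X'x yY' /orP]]] := tile_parent tG Gxy.
have [| |eX eY] := tile_disjoint tG GXY G'; [lra..|rewrite -eX -eY].
rewrite mulrDl mul1r => -[lt_X|lt_Y].
- have [w Gwx] := tile_left tG Gxy; have wx := tile_lt tG Gwx.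
  have [||Xw _] := tile_nested Gwx GXY; [lra..|].
  have [+ _] := cr _ _ _ _ Gwx Gxy; rewrite /= mulrC -ler_pdivrMr //.
  by rewrite [_ / _]mulrC; lra.
- have [z Gyz] := tile_right tG Gxy; have yz := tile_lt tG Gyz.
  have [||_ zY] := tile_nested Gyz GXY; [lra..|].
  have [_ +] := cr _ _ _ _ Gxy Gyz; rewrite /= mulrC -ler_pdivrMr //.
  by rewrite [_ / _]mulrC; lra.
Qed.

Lemma tile_ancestor rho sigma f k n x y : (0 < a)%N -> 1 < rho -> 1 <= sigma ->
  {homo f : x y / x <= y} ->
  comparable_tiles G rho id -> comparable_tiles G sigma f ->
  G (k + n)%N x y -> exists X Y, [/\ G n X Y, X <= x, y <= Y,
    (1 + rho^-1) ^+ k * (y - x) <= Y - X &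
    f Y - f X <= (a%:R * sigma ^+ a) ^+ k * (f y - f x)].
Proof.
move=> a0 r1 s1 fm cr cf; elim: k x y => [|k IH] x y.
  by exists x, y; rewrite !expr0 !mul1r; split.
rewrite addSn => Gxy.
have [X [Y [GXY Xx yY _]]] := tile_parent tG Gxy.
have [U [V [GUV UX YV le1 le2]]] := IH _ _ GXY.
have r0 : 0 <= 1 + rho^-1 by rewrite addr_ge0 // invr_ge0; lra.
have s0 : 0 <= a%:R * sigma ^+ a by rewrite mulr_ge0 ?exprn_ge0 //; lra.
exists U, V; split=> //; [lra|lra| |].
- apply: le_trans le1; rewrite exprSr -mulrA ler_wpM2l ?exprn_ge0 //.
  exact: tile_child_le GXY Gxy _ _.
- apply: (le_trans le2); rewrite exprSr -mulrA ler_wpM2l ?exprn_ge0 //.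
  exact: tile_child_ge GXY Gxy _ _.
Qed.

(** * Doubling at every scale *)

Lemma degree1_nat f x n : (forall x, f (x + 1) = f x + 1) ->
  f (x + n%:R) = f x + n%:R.
Proof.
move=> f1; elim: n => [|n IH]; first by rewrite !addr0.
by rewrite -natr1 !addrA f1 IH.
Qed.

(** Three cases: scales above [1 / 2], scales reached within [k] generations of level 0, and the
    remaining small scales. The factor [7 + 2 * sigma] dominates their constants [7], [3] and
    [1 + 2 * sigma]. *)
Lemma tile_doubling rho sigma f k m s : (0 < a)%N -> 1 < rho -> 1 <= sigma ->
  {homo f : x y / x <= y} -> (forall x, f (x + 1) = f x + 1) ->
  comparable_tiles G rho id -> comparable_tiles G sigma f ->
  3 * rho <= (1 + rho^-1) ^+ k -> 0 < s ->
  exists p q, [/\ p <= m - 3 * s, m + 3 * s <= q & f q - f p <=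
    (7 + 2 * sigma) * (a%:R * sigma ^+ a) ^+ k.+1 * (f (m + s) - f (m - s))].
Proof.
move=> a0 r1 s1 fm f1 cr cf hk s0.
set C := a%:R * sigma ^+ a; set mu := f (m + s) - f (m - s).
have C1 : 1 <= C by rewrite mulr_ege1 ?exprn_ege1 // ler1n.
have mu0 : 0 <= mu by rewrite subr_ge0 fm //; lra.
have [s_le|s_gt] := leP s (1 / 2); last first.
  exists (m - 3 * s), (m + 3 * s); split=> //.
  have CK : 7 <= (7 + 2 * sigma) * C ^+ k.+1.
    apply: (@le_trans _ _ (7 + 2 * sigma)); first lra.
    by rewrite ler_peMr ?exprn_ege1 //; lra.
  apply: le_trans (_ : 7 * mu <= _); last by rewrite ler_wpM2r.
  (* At large scales the degree suffices: [mu >= N], while [[m - 3 s, m + 3 s]] has [f]-size at most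
     [N' + 1], which is below [3 N + 4 <= 7 N] because [N >= 1]. *)
  have /andP[N1 N2] := truncn_itv (ltW (mulr_gt0 (ltr0Sn _ 1) s0)).
  have /andP[N3 N4] := truncn_itv (ltW (mulr_gt0 (ltr0Sn _ 5) s0)).
  set N := Num.truncn (2 * s) in N1 N2; set N' := Num.truncn _ in N3 N4.
  have : f (m - s + N%:R) <= f (m + s) by apply: fm; lra.
  have : f (m + 3 * s) <= f (m - 3 * s + N'.+1%:R) by apply: fm; lra.
  have N0 : 1 <= N%:R :> R.
    rewrite ler1n lt0n; apply/eqP => N0; move: N2; rewrite N0; lra.
  by rewrite !degree1_nat // /mu; move: N2; rewrite -!natr1; lra.
have r0 : 0 < rho by lra.
have q1 : 1 < 1 + rho^-1 by rewrite ltrDl invr_gt0.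
(* Climbing from level [n] to level 0, where tiles have length 1, shows that a tile of level [n] has
   length at most [(1 + rho^-1) ^- n]. *)
have exn : exists n, `[< exists x y, [/\ G n x y, x <= m <= y & y - x <= s] >].
  have [n hn] := expr_unbounded s^-1 q1.
  exists n; apply/asboolP.
  have [x [y [Gxy mxy]]] := tile_cover tG n m.
  exists x, y; split=> //; rewrite -[n]addn0 in Gxy.
  have [X [Y [/(tile0 tG)-> _ _ + _]]] := tile_ancestor a0 r1 s1 fm cr cf Gxy.
  rewrite (addrC X) addrK => le1.
  have xy := tile_lt tG Gxy.
  have : s^-1 * (y - x) <= 1.
    by apply: le_trans le1; rewrite ler_wpM2r // subr_ge0 ltW.
  by rewrite mulrC ler_pdivrMr // mul1r.
case: (ex_minnP exn) => n /asboolP[x [y [Gxy /andP[xm my] yxs]]] minn.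
have muxy : f y - f x <= mu by rewrite /mu lerB // fm //; lra.
case: n => [|n] in Gxy minn *.
  by have := tile0 tG Gxy; lra.
have C0 : 0 <= C by lra.
(* When [n < k], climb all the way to level 0, where a tile has [f]-size 1; since [6 s <= 3], three
   periods cover the tripled interval. *)
have [kn|nk] := leqP k n; last first.
  exists (m - 3 * s), (m + 3 * s); split=> //.
  have : f (m + 3 * s) <= f (m - 3 * s + 3%:R) by apply: fm; lra.
  rewrite degree1_nat // => le3.
  rewrite -[n.+1]addn0 in Gxy.
  have [X [Y [/(tile0 tG)-> _ _ _]]] := tile_ancestor a0 r1 s1 fm cr cf Gxy.
  rewrite f1 (addrC (f X)) addrK -/C => le1.
  have : C ^+ n.+1 * (f y - f x) <= C ^+ k.+1 * mu.
    rewrite ler_pM ?exprn_ge0 ?subr_ge0 ?fm ?ler_weXn2l //; first lra.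
    by rewrite ltnW.
  move=> le2; rewrite -mulrA.
  apply: le_trans (_ : 3 * (C ^+ k.+1 * mu) <= _); first lra.
  rewrite ler_wpM2r ?mulr_ge0 ?exprn_ge0 //; lra.
have [X0 [Y0 [G0 X0x yY0 _]]] := tile_parent tG Gxy.
have s_lt : s < Y0 - X0.
  rewrite ltNge; apply/negP => sle.
  have /minn : `[< exists x y, [/\ G n x y, x <= m <= y & y - x <= s] >].
    apply/asboolP; exists X0, Y0; split=> //.
    by rewrite (le_trans X0x) ?(le_trans my).
  by rewrite ltnn.
have fle := tile_child_ge s1 fm cf G0 Gxy X0x yY0.
rewrite -(subnKC kn) in G0.
have [X [Y [GXY XX0 Y0Y le1 le2]]] := tile_ancestor a0 r1 s1 fm cr cf G0.
have [Z GYZ] := tile_right tG GXY; have [W GWX] := tile_left tG GXY.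
(* The factor [rho] is spent on passing to the neighbours: each of them still has length at least
   [3 s], and [m] lies in [[X, Y]]. *)
have lenXY : rho * (3 * s) <= Y - X.
  apply: le_trans le1; rewrite mulrA (mulrC rho).
  by apply: ler_pM => //; lra.
exists W, Z; split.
- have [+ _] := cr _ _ _ _ GWX GXY => /(le_trans lenXY).
  by rewrite ler_pM2l //=; lra.
- have [_ +] := cr _ _ _ _ GXY GYZ => /(le_trans lenXY).
  by rewrite ler_pM2l //=; lra.
have [fYZ _] := cf _ _ _ _ GXY GYZ; have [_ fWX] := cf _ _ _ _ GWX GXY.
have fXY : f Y - f X <= C ^+ k.+1 * mu.
  apply: (le_trans le2); rewrite exprSr -mulrA ler_wpM2l ?exprn_ge0 //.
  by apply: (le_trans fle); rewrite ler_wpM2l.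
have CM : 0 <= C ^+ k.+1 * mu by rewrite mulr_ge0 ?exprn_ge0.
apply: le_trans (_ : (1 + 2 * sigma) * (f Y - f X) <= _); first lra.
rewrite -mulrA; apply: ler_pM => //; [lra| |lra].
by rewrite subr_ge0 fm // (ltW (tile_lt tG GXY)).
Qed.

(** Tripling about the midpoint of one of the two intervals swallows the other: for [m = x - t / 2]
    the large interval is [[x - 2 t, x + t]]. *)
Lemma tile_quasisymmetric rho sigma f k x t :
  (0 < a)%N -> 1 < rho -> 1 <= sigma ->
  {homo f : x y / x <= y} -> (forall x, f (x + 1) = f x + 1) ->
  comparable_tiles G rho id -> comparable_tiles G sigma f ->
  3 * rho <= (1 + rho^-1) ^+ k -> 0 < t ->
  let K := (7 + 2 * sigma) * (a%:R * sigma ^+ a) ^+ k.+1 in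
  f (x + t) - f x <= K * (f x - f (x - t)) /\
  f x - f (x - t) <= K * (f (x + t) - f x).
Proof.
move=> a0 r1 s1 fm f1 cr cf hk t0 K; have t20 : 0 < t / 2 by lra.
split.
- have [p [q []]] := tile_doubling (x - t / 2) a0 r1 s1 fm f1 cr cf hk t20.
  have -> : x - t / 2 - t / 2 = x - t by lra.
  rewrite -/K subrK => pm mq le_pq.
  have fp : f p <= f x by apply: fm; lra.
  have fq : f (x + t) <= f q by apply: fm; lra.
  lra.
- have [p [q []]] := tile_doubling (x + t / 2) a0 r1 s1 fm f1 cr cf hk t20.
  have -> : x + t / 2 + t / 2 = x + t by lra.
  rewrite -/K addrK => pm mq le_pq.
  have fp : f p <= f (x - t) by apply: fm; lra.
  have fq : f x <= f q by apply: fm; lra.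
  lra.
Qed.

End tiling.

(** * Intervals of the circle *)

Section circle_intervals.
Context (R : realType).
Implicit Types (x y z u v w : R) (A B : set (circle R)) (p : circle R).

Lemma int_eq0 z : z \is a Num.int -> -1 < z < 1 -> z = 0.
Proof.
move=> /intrP[k ->]; rewrite -[- 1]/((- 1)%:~R) -[1]/(1%:~R) !ltr_int.
by case: k => [[|?]|[|?]].
Qed.

Lemma circle_pi_ex p : exists x, circle_pi x = p.
Proof. by exists (repr p); exact: reprK. Qed.

Lemma circle_piDint x z : z \is a Num.int -> circle_pi (x + z) = circle_pi x.
Proof. by move=> zZ; apply/circle_piP; rewrite addrAC subrr add0r. Qed.

Lemma int_shift x y : exists2 z, z \is a Num.int & x <= y + z < x + 1.
Proof.
exists (- (Num.floor (y - x))%:~R); first by rewrite rpredN intr_int.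
have /andP[] := floor_itv (y - x); rewrite intrD => ? ?.
by apply/andP; split; lra.
Qed.

Lemma interval_from_to_lt A x y : interval_from_to A x y -> x < y <= x + 1.
Proof. by case. Qed.

Lemma interval_mem A x y w : interval_from_to A x y -> x <= w <= y ->
  A (circle_pi w).
Proof. by case=> _ -> xwy; exists w => //=; rewrite in_itv. Qed.

(** A lift of the same point in [[x, y]] and to the left of [w] would differ from [w] by an integer
    strictly between -1 and 0. *)
Lemma interval_mem_right A x y w : interval_from_to A x y -> x <= w < x + 1 ->
  A (circle_pi w) -> w <= y.
Proof.
move=> [/andP[xy yx1] ->] /andP[xw wx1] [s /=]; rewrite in_itv /=.
move=> /andP[xs sy] /circle_piP swZ.
have [ws|sw] := leP w s; first exact: le_trans sy.
have /eqP : s - w = 0 by apply: int_eq0 => //; apply/andP; split; lra.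
by rewrite subr_eq0 => /eqP <-.
Qed.

Lemma interval_mem_left A x y w : interval_from_to A x y -> y - 1 < w <= y ->
  A (circle_pi w) -> x <= w.
Proof.
move=> [/andP[xy yx1] ->] /andP[yw wy] [s /=]; rewrite in_itv /=.
move=> /andP[xs sy] /circle_piP swZ.
have [sw|ws] := leP s w; first exact: le_trans sw.
have /eqP : s - w = 0 by apply: int_eq0 => //; apply/andP; split; lra.
by rewrite subr_eq0 => /eqP <-.
Qed.

Lemma interval_setT x : interval_from_to [set: circle R] x (x + 1).
Proof.
split; first by rewrite lexx ltrDl ltr01.
apply/esym/seteqP; split=> // p _; have [w <-] := circle_pi_ex p.
have [z zZ /andP[xw wx]] := int_shift x w.
by exists (w + z); rewrite ?circle_piDint //= in_itv /= xw ltW.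
Qed.

Lemma interval_proper A x y : interval_from_to A x y -> A <> setT -> y < x + 1.
Proof.
move=> Axy AT; have /andP[_ yx] := interval_from_to_lt Axy.
rewrite lt_neqAle yx andbT; apply/eqP => yE; apply: AT.
by have [_ ->] := Axy; rewrite yE; have [_ <-] := interval_setT x.
Qed.

Lemma interval_shift A x y w : interval_from_to A x y -> A (circle_pi w) ->
  exists2 z, z \is a Num.int & x + z <= w <= y + z.
Proof.
move=> [_ ->] [s]; rewrite /= in_itv /= => /andP[xs sy] /circle_piP swZ.
by exists (w - s); [rewrite -opprB rpredN|apply/andP; split; lra].
Qed.

(** The whole circle is excluded because it may be cut anywhere. Otherwise the lengths agree, so a
    lift starting strictly after [x], within one period, also ends after [y] and shows points of [A]
    beyond [y]. *)
Lemma interval_unique A x y x' y' : A <> setT ->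
  interval_from_to A x y -> interval_from_to A x' y' ->
  x' - x \is a Num.int /\ y' - y = x' - x.
Proof.
move=> AT Axy Ax'y'; have len := interval_lengthE Axy.
have yx1 := interval_proper Axy AT.
rewrite (interval_lengthE Ax'y') in len; split; last by lra.
have [z zZ] := int_shift x x'; have := interval_from_to_shift Ax'y' zZ.
set X := x' + z; set Y := y' + z => AXY /andP[xX Xx1].
have {}len : Y - X = y - x by rewrite /X /Y; lra.
suff xE : X = x.
  by have -> : x' - x = - z; [move: xE; rewrite /X; lra|rewrite rpredN].
have XY : X < Y by have /andP[] := interval_from_to_lt AXY.
apply/eqP; rewrite eq_le xX andbT leNgt; apply/negP => ltxX.
have Xy : X <= y.
  by apply: (interval_mem_right Axy); rewrite ?xX //; apply: interval_mem AXY _;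
    rewrite lexx ltW.
(* A point of [A] past [y], kept below [x + 1] so that [interval_mem_right] applies. *)
pose w := (y + Num.min Y (x + 1)) / 2.
have yw : y < Num.min Y (x + 1) by rewrite lt_min; apply/andP; split; lra.
have wY : Num.min Y (x + 1) <= Y by rewrite ge_min lexx.
have wx1 : Num.min Y (x + 1) <= x + 1 by rewrite ge_min lexx orbT.
have : w <= y.
  apply: (interval_mem_right Axy); first by rewrite /w; apply/andP; split; lra.
  by apply: interval_mem AXY _; rewrite /w; apply/andP; split; lra.
rewrite /w; lra.
Qed.

(** By uniqueness of the lift up to integers, the only endpoints of [A] are the classes of [x] and
    [y]. For the whole circle every point is an endpoint. *)
Lemma interval_interior A x y w : A <> setT -> interval_from_to A x y ->
  x < w < y -> ~ endpoint A (circle_pi w).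
Proof.
move=> AT Axy /andP[xw wy] [x' [y' [Ax'y' pw]]].
have yx1 := interval_proper Axy AT.
have [x'x y'y] := interval_unique AT Axy Ax'y'.
case: pw => /circle_piP wZ.
- have : w - x = 0 by apply: int_eq0; [rewrite -(subrKA x') rpredD|lra].
  by lra.
- have : w - y = 0.
    by apply: int_eq0; [rewrite -(subrKA y') rpredD ?y'y|lra].
  by lra.
Qed.

Lemma interval_left_end A x y : interval_from_to A x y ->
  endpoint A (circle_pi x).
Proof. by move=> Axy; exists x, y; split=> //; left. Qed.

Lemma interval_right_end A x y : interval_from_to A x y ->
  endpoint A (circle_pi y).
Proof. by move=> Axy; exists x, y; split=> //; right. Qed.

Lemma circle_interval_closed A : closed_interval A ->
  closed (@circle_pi R @^-1` A).
Proof.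
move=> [x [y Axy]]; rewrite -openC openE => w /= wA.
have [z zZ /andP[xw wx]] := int_shift x w.
have ywz : y < w + z.
  rewrite ltNge; apply/negP => wy; apply: wA; rewrite -(circle_piDint _ zZ).
  by apply: interval_mem Axy _; rewrite xw.
have /andP[xy _] := interval_from_to_lt Axy.
have : \forall s \near w, s \in `]y - z, x + 1 - z[.
  by apply: near_in_itvoo; rewrite in_itv /=; apply/andP; split; lra.
rewrite /interior /=; apply: filterS => s /=; rewrite in_itv /= => /andP[s1 s2].
rewrite -(circle_piDint _ zZ) => /(interval_mem_right Axy) h.
suff : s + z <= y by lra.
by apply: h; apply/andP; split; lra.
Qed.

End circle_intervals.

(** * Atoms of a partition *)

Section partition.
Context (R : realType) (P : set (set (circle R))) (PP : circle_partition P).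
Implicit Types (x y z u v w : R) (A B : set (circle R)) (p : circle R).

Lemma atom_interval A : P A -> exists x y, interval_from_to A x y.
Proof. by case: PP => _ + _ _; apply. Qed.

Lemma atom_cover p : exists2 A, P A & A p.
Proof.
by case: PP => _ _ + _ => PT; have : [set: circle R] p by []; rewrite -PT.
Qed.

Lemma atom_interior_unique A B x y w : P A -> P B -> A <> setT ->
  interval_from_to A x y -> x < w < y -> B (circle_pi w) -> A = B.
Proof.
move=> PA PB AT Axy xwy Bw; apply: contrapT => AB.
case: PP => _ _ _ /(_ _ _ PA PB AB (circle_pi w)) [].
  by split=> //; apply: interval_mem Axy _; case/andP: xwy => ? ?; rewrite !ltW.
by move/(interval_interior AT Axy xwy).
Qed.

Lemma atom_overlap A B x y u v : P A -> P B -> A <> setT ->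
  interval_from_to A x y -> interval_from_to B u v -> x < v -> u < y -> A = B.
Proof.
move=> PA PB AT Axy Buv xv uy.
have /andP[xy _] := interval_from_to_lt Axy.
have /andP[uv _] := interval_from_to_lt Buv.
have [w /andP[xw wy] /andP[uw wv]] : exists2 w, x < w < y & u <= w <= v.
  exists ((Num.max x u + Num.min y v) / 2).
  - have [xu|ux] := leP x u; have [yv|vy] := leP y v;
    by apply/andP; split; lra.
  - have [xu|ux] := leP x u; have [yv|vy] := leP y v;
    by apply/andP; split; lra.
apply: (atom_interior_unique PA PB AT Axy (w := w)); first by rewrite xw.
by apply: interval_mem Buv _; rewrite uw.
Qed.

Lemma atom_overlap_eq A B x y u v : P A -> P B -> A <> setT ->
  interval_from_to A x y -> interval_from_to B u v -> x < v -> u < y ->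
  x = u /\ y = v.
Proof.
move=> PA PB AT Axy Buv xv uy.
have AB := atom_overlap PA PB AT Axy Buv xv uy.
rewrite -AB in Buv; have [uxZ vy] := interval_unique AT Axy Buv.
have /andP[_ yx1] := interval_from_to_lt Axy.
have /andP[_ vu1] := interval_from_to_lt Buv.
have : u - x = 0 by apply: int_eq0 => //; apply/andP; split; lra.
by lra.
Qed.

Lemma atom_cover_lift m : exists A x y,
  [/\ P A, interval_from_to A x y & x <= m <= y].
Proof.
have [A PA Am] := atom_cover (circle_pi m).
have [x [y Axy]] := atom_interval PA.
have [z zZ xmy] := interval_shift Axy Am.
by exists A, (x + z), (y + z); split=> //; apply: interval_from_to_shift.
Qed.

(* The other atoms have closed union, which therefore omits a neighbourhood of
   a point it does not contain. *)
Lemma atom_nbhs A y : P A ->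
  (forall B, P B -> B <> A -> ~ B (circle_pi y)) ->
  exists2 e, 0 < e & forall w, `|w - y| < e -> A (circle_pi w).
Proof.
move=> PA notB.
have cl : closed (\bigcup_(B in P `\ A) (@circle_pi R @^-1` B)).
  apply: closed_bigcup => [|B [PB _]].
    by apply: finite_setD; case: PP.
    apply: circle_interval_closed.
    by have [u [v]] := atom_interval PB; exists u, v.
have : \forall w \near y, ~ (\bigcup_(B in P `\ A) (@circle_pi R @^-1` B)) w.
  move: cl; rewrite -openC openE; apply => -[B [PB BA]].
  exact: notB.
move=> /nbhs_ballP[e /= e0 ye]; exists e => // w yw.
have [B PB Bw] := atom_cover (circle_pi w).
have [<- //|BA] := pselect (B = A).
case: (ye w); last by exists B.
by rewrite /ball /= distrC.
Qed.

Lemma atom_other A y : P A ->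
  (forall e, 0 < e -> exists2 w, `|w - y| < e & ~ A (circle_pi w)) ->
  exists B, [/\ P B, B <> A & B (circle_pi y)].
Proof.
move=> PA notA; apply: contrapT => noB.
have [|e e0 Ae] := atom_nbhs (y := y) PA.
  by move=> B PB BA By; apply: noB; exists B.
by have [w /Ae] := notA _ e0.
Qed.

(** Points just outside [A] accumulate at its endpoint, so a second atom contains that endpoint;
    distinct atoms meet only in endpoints of both. *)
Lemma atom_neighbor A x y p : P A -> A <> setT -> interval_from_to A x y ->
  p = circle_pi x \/ p = circle_pi y -> exists B u v,
  [/\ P B, B <> A, interval_from_to B u v &
      p = circle_pi u \/ p = circle_pi v].
Proof.
move=> PA AT Axy pE; have yx1 := interval_proper Axy AT.
have /andP[xy _] := interval_from_to_lt Axy.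
have Ap : A p.
  by case: pE => ->; apply: interval_mem Axy _; rewrite lexx ltW.
have [B [PB BA Bp]] : exists B, [/\ P B, B <> A & B p].
  case: pE => ->; apply: atom_other => // e e0.
  (* The bound by the length of the complementary gap keeps [x - d / 2] from re-entering [A] from
     the other side. *)
  - pose d := Num.min e (x + 1 - y).
    have d0 : 0 < d by rewrite lt_min e0 /=; lra.
    have de : d <= e by rewrite ge_min lexx.
    have dy : d <= x + 1 - y by rewrite ge_min lexx orbT.
    exists (x - d / 2).
      by rewrite addrAC subrr add0r normrN ger0_norm; lra.
    move=> /(interval_mem_left Axy) h.
    suff : x <= x - d / 2 by lra.
    by apply: h; apply/andP; split; lra.
  - pose d := Num.min e (x + 1 - y).
    have d0 : 0 < d by rewrite lt_min e0 /=; lra.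
    have de : d <= e by rewrite ge_min lexx.
    have dy : d <= x + 1 - y by rewrite ge_min lexx orbT.
    exists (y + d / 2).
      by rewrite addrAC subrr add0r ger0_norm; lra.
    move=> /(interval_mem_right Axy) h.
    suff : y + d / 2 <= y by lra.
    by apply: h; apply/andP; split; lra.
case: PP => _ _ _ /(_ _ _ PB PA BA p) [] // [u [v [Buv puv]]] _.
by exists B, u, v.
Qed.

(** The neighbour at [y] must have [y] as its left end: if it ended at [y], it would overlap [A] and
    hence equal it. *)
Lemma atom_right A x y : P A -> A <> setT -> interval_from_to A x y ->
  exists B z, [/\ P B, B <> A & interval_from_to B y z].
Proof.
move=> PA AT Axy; have /andP[xy _] := interval_from_to_lt Axy.
have [B [u [v [PB BA Buv]]]] := atom_neighbor PA AT Axy (or_intror erefl).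
have /andP[uv _] := interval_from_to_lt Buv.
case=> /circle_piP yZ; have := interval_from_to_shift Buv yZ.
- by rewrite addrC subrK => By; exists B, (v + (y - u)); split.
- rewrite [v + _]addrC subrK => By; exfalso; apply: BA; apply/esym.
  by apply: (atom_overlap PA PB AT Axy By); lra.
Qed.

Lemma atom_left A x y : P A -> A <> setT -> interval_from_to A x y ->
  exists B z, [/\ P B, B <> A & interval_from_to B z x].
Proof.
move=> PA AT Axy; have /andP[xy _] := interval_from_to_lt Axy.
have [B [u [v [PB BA Buv]]]] := atom_neighbor PA AT Axy (or_introl erefl).
have /andP[uv _] := interval_from_to_lt Buv.
case=> /circle_piP yZ; have := interval_from_to_shift Buv yZ.
- rewrite [u + _]addrC subrK => By; exfalso; apply: BA; apply/esym.
  by apply: (atom_overlap PA PB AT Axy By); lra.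
- by rewrite [v + _]addrC subrK => By; exists B, (u + (x - v)); split.
Qed.

Lemma atom_subset A B : P A -> P B -> B <> setT -> B `<=` A -> A = B.
Proof.
move=> PA PB BT BA; have [x [y Bxy]] := atom_interval PB.
have /andP[xy _] := interval_from_to_lt Bxy.
apply/esym/(atom_interior_unique PB PA BT Bxy (w := (x + y) / 2)).
  by apply/andP; split; lra.
by apply: BA; apply: interval_mem Bxy _; apply/andP; split; lra.
Qed.

End partition.

(** If [[x, y]] stuck out of [[X, Y]], a point of it just outside, within the gap of length
    [X + 1 - Y], would project outside [B]. *)
Lemma interval_nested (R : realType) (A B : set (circle R)) (x y X Y : R) :
  B <> setT -> interval_from_to A x y -> interval_from_to B X Y -> A `<=` B ->
  X < y -> x < Y -> X <= x /\ y <= Y.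
Proof.
move=> BT Axy BXY AB Xy xY.
have YX1 := interval_proper BXY BT.
have /andP[xy _] := interval_from_to_lt Axy.
have /andP[XY _] := interval_from_to_lt BXY.
have mem w : x <= w <= y -> B (circle_pi w).
  by move=> xwy; apply: AB; apply: interval_mem Axy _.
split; rewrite leNgt; apply/negP => lt_.
- pose d := Num.max x (Y - 1).
  have xd : x <= d by rewrite le_max lexx.
  have Yd : Y - 1 <= d by rewrite le_max lexx orbT.
  have dX : d < X by rewrite gt_max lt_ /=; lra.
  suff : X <= (d + X) / 2 by lra.
  apply: (interval_mem_left BXY); first by apply/andP; split; lra.
  by apply: mem; apply/andP; split; lra.
- pose d := Num.min y (X + 1).
  have yd : d <= y by rewrite ge_min lexx.
  have Yd : d <= X + 1 by rewrite ge_min lexx orbT.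
  have dX : Y < d by rewrite lt_min lt_ /=; lra.
  suff : (d + Y) / 2 <= Y by lra.
  apply: (interval_mem_right BXY); first by apply/andP; split; lra.
  by apply: mem; apply/andP; split; lra.
Qed.

(** * The tiling lifted from a fine grid *)

(* The only atom of [Q 0] is the whole circle; cutting it at the lifts of [c]
   keeps the partitions nested when [c] lifts an endpoint of [Q 1]. *)
Definition grid_tile (R : realType) (Q : nat -> set (set (circle R))) (c : R)
    (n : nat) (x y : R) : Prop :=
  [/\ Q n (@circle_pi R @` `[x, y]), x < y <= x + 1 &
      n = 0%N -> x - c \is a Num.int].

Lemma card_ge2P (T : Type) (F : set T) : `I_2 #<= F ->
  exists A B, [/\ F A, F B & A <> B].
Proof.
move=> F2; have [A FA] : F !=set0.
  apply/set0P/eqP => F0; rewrite F0 in F2.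
  have := card_le_trans F2 (card_ge0 T `I_0).
  by rewrite card_le_II.
apply: contrapT => noB.
have F1 : F = [set A].
  apply/seteqP; split=> [B FB|_ ->//]; apply: contrapT => BA.
  by apply: noB; exists B, A; split.
by move: F2; rewrite F1 (card_le_eqr card_set1) card_le_II.
Qed.

Section grid.
Context (R : realType) (a : nat) (rho : R) (Q : nat -> set (set (circle R))).
Context (gQ : fine_grid a rho Q).
Implicit Types (x y z u v w : R) (A B : set (circle R)).

Lemma grid_partition n : circle_partition (Q n).
Proof. by case: gQ => -[]. Qed.

(** Strict refinement yields at least two atoms, and the whole circle cannot share a partition with
    another atom. Hence lifts are unique up to integers at all positive levels. *)
Lemma grid_atom_proper n A : Q n.+1 A -> A <> setT.
Proof.
move=> QA AT; have [_ ref _ _] := gQ.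
have [D QD _] := atom_cover (grid_partition n) (circle_pi 0).
have [F [FQ _ F2]] := ref _ _ QD.
have [B [QB BA]] : exists B, Q n.+1 B /\ B <> A.
  have [B1 [B2 [/FQ Q1 /FQ Q2 B12]]] := card_ge2P F2.
  have [B1A|] := pselect (B1 = A); last by exists B1.
  by exists B2; split=> // B2A; apply: B12; rewrite B1A B2A.
apply/BA/esym/(atom_subset (grid_partition _) QA QB); last by rewrite AT.
by rewrite -AT.
Qed.

(** The atom [D] around the midpoint of [B] is a union of finer atoms, and the one through that
    midpoint is [B]. If [B = D], all these finer atoms would coincide with [B]. *)
Lemma grid_parent n B : Q n.+1 B -> exists2 D, Q n D & B `<=` D /\ B <> D.
Proof.
move=> QB; have BT := grid_atom_proper QB.
have [x [y Bxy]] := atom_interval (grid_partition n.+1) QB.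
have /andP[xy _] := interval_from_to_lt Bxy.
have mid : x < (x + y) / 2 < y by apply/andP; split; lra.
have [D QD Dw] := atom_cover (grid_partition n) (circle_pi ((x + y) / 2)).
have [_ ref _ _] := gQ; have [F [FQ DE F2]] := ref _ _ QD.
exists D => //.
have FD A : F A -> A `<=` D by move=> FA p Ap; rewrite DE; exists A.
have [B' FB' Bw'] : (\bigcup_(B in F) B) (circle_pi ((x + y) / 2)).
  by rewrite -DE.
have BB' : B = B' :=
  atom_interior_unique (grid_partition _) QB (FQ _ FB') BT Bxy mid Bw'.
split; first by rewrite BB'; exact: FD.
move=> BD; have only A : F A -> A = B.
  move=> FA; apply/esym/(atom_subset (grid_partition n.+1)) => //.
    exact: FQ.
    exact/grid_atom_proper/FQ.
  by rewrite BD; exact: FD.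
have [B1 [B2 [F1 F2' B12]]] := card_ge2P F2.
by apply: B12; rewrite (only _ F1) (only _ F2').
Qed.

(** Each [f i] belongs to the family of at most [a] atoms with union [D], since a member of the
    family contains the midpoint of [f i]. *)
Lemma grid_children_card n D (f : nat -> set (circle R)) : Q n D ->
  (forall i, (i <= a)%N -> Q n.+1 (f i) /\ f i `<=` D) ->
  (forall i j, (i < j <= a)%N -> f i <> f j) -> False.
Proof.
move=> QD fQ finj; have [_ _ [_ /(_ _ _ QD)[F [FQ DE Fa]]] _] := gQ.
have fF i : (i <= a)%N -> F (f i).
  move=> /fQ[Qi fD]; have iT := grid_atom_proper Qi.
  have [x [y fxy]] := atom_interval (grid_partition n.+1) Qi.
  have /andP[xy _] := interval_from_to_lt fxy.
  have mid : x < (x + y) / 2 < y by apply/andP; split; lra.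
  have : D (circle_pi ((x + y) / 2)).
    by apply: fD; apply: interval_mem fxy _; apply/andP; split; lra.
  rewrite DE => -[B FB Bw].
  have partQ := grid_partition n.+1.
  by rewrite (atom_interior_unique partQ Qi (FQ _ FB) iT fxy mid Bw).
have : `I_a.+1 #<= F.
  apply/pcard_leP/injfunPex; exists f => [i /= ia|i j]; first exact: fF.
  rewrite !inE /= => ia ja fij.
  by have [ij|ji|//] := ltngtP i j; [case: (finj i j)|case: (finj j i)];
    rewrite ?ij ?ji.
by move=> /card_le_trans/(_ Fa); rewrite card_le_II ltnn.
Qed.

Context (c : R) (hc : exists z, grid_tile Q c 1 c z).

Lemma grid_tile_cover n m : exists x y, grid_tile Q c n x y /\ x <= m <= y.
Proof.
case: n => [|n].
  have [z zZ /andP[h1 h2]] := int_shift c m.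
  exists (c - z), (c - z + 1); split; last by apply/andP; split; lra.
  have [xy E] := interval_setT (c - z); split=> // [|_].
    by rewrite -E; have [[_ ->]] := gQ.
  by rewrite addrAC subrr add0r rpredN.
have [A [x [y [QA Axy xmy]]]] := atom_cover_lift (grid_partition n.+1) m.
by exists x, y; split=> //; case: Axy => xy AE; split=> //; rewrite -AE.
Qed.

Lemma grid_tile_interval n x y : grid_tile Q c n x y ->
  interval_from_to (@circle_pi R @` `[x, y]) x y.
Proof. by case. Qed.

Lemma grid_tile0 x y : grid_tile Q c 0 x y -> y = x + 1.
Proof.
move=> G; have [QA xy _] := G; have := interval_lengthE (grid_tile_interval G).
have [[_ Q0] _ _ _] := gQ; move: QA; rewrite Q0 => ->.
by rewrite (interval_lengthE (interval_setT 0)); lra.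
Qed.

Lemma grid_tile0_intro x : x - c \is a Num.int -> grid_tile Q c 0 x (x + 1).
Proof.
move=> xZ; have [xy E] := interval_setT x; split=> //.
by rewrite -E; have [[_ ->]] := gQ.
Qed.

Lemma grid_tile_shift n x y z : grid_tile Q c n x y -> z \is a Num.int ->
  grid_tile Q c n (x + z) (y + z).
Proof.
move=> G zZ; have [QA xy xZ] := G.
have [xy' AE] := interval_from_to_shift (grid_tile_interval G) zZ.
split=> //; first by rewrite -AE.
by move=> /xZ xcZ; rewrite addrAC rpredD.
Qed.

Lemma grid_tile_disjoint n x y u v : grid_tile Q c n x y ->
  grid_tile Q c n u v -> x < v -> u < y -> x = u /\ y = v.
Proof.
case: n => [|n] Gx Gu xv uy; last first.
  have [QA _ _] := Gx; have [QB _ _] := Gu.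
  exact: (atom_overlap_eq (grid_partition n.+1) QA QB (grid_atom_proper QA)
           (grid_tile_interval Gx) (grid_tile_interval Gu)).
move: (Gx) (Gu) xv uy => /grid_tile0-> /grid_tile0-> xv uy.
have [_ _ /(_ erefl) xZ] := Gx; have [_ _ /(_ erefl) uZ] := Gu.
have : x - u = 0.
  apply: int_eq0; last by apply/andP; split; lra.
  by rewrite -(subrKA c) rpredD // -opprB rpredN.
by lra.
Qed.

Lemma grid_tile_right n x y : grid_tile Q c n x y ->
  exists z, grid_tile Q c n y z.
Proof.
case: n => [|n] G.
  have yE := grid_tile0 G; have [_ _ /(_ erefl) xZ] := G.
  exists (y + 1); apply: grid_tile0_intro.
  by rewrite yE addrAC rpredD ?rpred1.
have [QA _ _] := G; have [B [z [QB _ [yz BE]]]] :=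
  atom_right (grid_partition n.+1) QA (grid_atom_proper QA)
    (grid_tile_interval G).
by exists z; split=> //; rewrite -BE.
Qed.

Lemma grid_tile_left n x y : grid_tile Q c n x y ->
  exists z, grid_tile Q c n z x.
Proof.
case: n => [|n] G.
  have yE := grid_tile0 G; have [_ _ /(_ erefl) xZ] := G.
  exists (x - 1); rewrite -{2}(subrK 1 x); apply: grid_tile0_intro.
  by rewrite addrAC rpredB ?rpred1.
have [QA _ _] := G; have [B [z [QB _ [yz BE]]]] :=
  atom_left (grid_partition n.+1) QA (grid_atom_proper QA)
    (grid_tile_interval G).
by exists z; split=> //; rewrite -BE.
Qed.

Lemma grid_tile_length n x y : grid_tile Q c n.+1 x y -> y < x + 1.
Proof.
move=> G; have [QA _ _] := G.
exact: interval_proper (grid_tile_interval G) (grid_atom_proper QA).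
Qed.

Lemma grid_tile_parent n x y : grid_tile Q c n.+1 x y -> exists X Y,
  [/\ grid_tile Q c n X Y, X <= x, y <= Y & (X < x) || (y < Y)].
Proof.
move=> G; have [QA /andP[xy _] _] := G; have Axy := grid_tile_interval G.
case: n => [|n] in G QA *.
  have [z zZ /andP[h1 h2]] := int_shift c x.
  have Zc : - z \is a Num.int by rewrite rpredN.
  have yx := grid_tile_length G.
  (* A tile of level 1 starts at [c - z + 1], so no tile of level 1 crosses this cut. *)
  have yc : y <= c - z + 1.
    rewrite leNgt; apply/negP => lty; have [d Gd] := hc.
    have [_ /andP[cd _] _] := Gd.
    have Z1 : 1 - z \is a Num.int by rewrite rpredB ?rpred1.
    by have [| |] := grid_tile_disjoint G (grid_tile_shift Gd Z1); lra.
  exists (c - z), (c - z + 1); split=> //.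
  - by apply: grid_tile0_intro; rewrite addrAC subrr add0r.
  - by lra.
  - by apply/orP; have [|] := ltP (c - z) x; [left|right; lra].
have [D QD [AD neAD]] := grid_parent QA; have DT := grid_atom_proper QD.
have [X0 [Y0 DXY0]] := atom_interval (grid_partition n.+1) QD.
(* Among the lifts of [D], take the one containing the midpoint of [[x, y]]. *)
have [|z zZ] := interval_shift DXY0 (w := (x + y) / 2).
  by apply: AD; apply: interval_mem Axy _; apply/andP; split; lra.
have := interval_from_to_shift DXY0 zZ.
move: (X0 + z) (Y0 + z) => X Y DXY /andP[Xw wY].
have [||Xx yY] := interval_nested DT Axy DXY AD; [lra..|].
exists X, Y; split=> //.
  by case: DXY => XY DE; split=> //; rewrite -DE.
apply/negPn; rewrite negb_or -!leNgt; apply/negP => /andP[xX Yy].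
apply: neAD; have -> : x = X by apply/eqP; rewrite eq_le xX.
have -> : y = Y by apply/eqP; rewrite eq_le Yy yY.
by case: DXY.
Qed.

(** Distinct tiles inside [[X, Y]] have distinct projections: otherwise their left ends, both in
    [[X, X + 1[], would differ by a nonzero integer. *)
Lemma grid_tile_card n X Y (y : nat -> R) : grid_tile Q c n X Y ->
  (forall i, (i <= a)%N -> grid_tile Q c n.+1 (y i) (y i.+1)) ->
  X <= y 0%N -> y a.+1 <= Y -> False.
Proof.
move=> GX Gy Xy yY; have [QD /andP[XY YX1] _] := GX.
have step i : (i <= a)%N -> y i < y i.+1 by move=> /Gy[_ /andP[]].
have mono i j : (i <= j <= a.+1)%N -> y i <= y j.
  move=> /andP[]; elim: j => [|j IH]; first by rewrite leqn0 => /eqP->.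
  rewrite leq_eqVlt => /predU1P[->//|ij ja].
  by apply: le_trans (IH ij (ltnW ja)) (ltW (step _ ja)).
have range i : (i <= a.+1)%N -> X <= y i <= Y.
  move=> ia; apply/andP; split.
    by apply: le_trans Xy (mono 0%N i _); rewrite ia.
  by apply: le_trans (mono i a.+1 _) yY; rewrite ia leqnn.
apply: (@grid_children_card n _ (fun i => @circle_pi R @` `[y i, y i.+1]) QD).
  move=> i ia; split; first by have [] := Gy _ ia.
  have /andP[Xi _] := range i (leqW ia); have /andP[_ Yi] := range i.+1 ia.
  move=> p [w /=]; rewrite in_itv /= => /andP[iw wi] <-.
  by exists w => //=; rewrite in_itv /=; apply/andP; split; lra.
move=> i j /andP[ij ja] E.
have ia : (i <= a)%N := leq_trans (ltnW ij) ja.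
have [QA _ _] := Gy _ ia.
have Ii := grid_tile_interval (Gy _ ia).
have Ij := grid_tile_interval (Gy _ ja); rewrite -E in Ij.
have [yZ _] := interval_unique (grid_atom_proper QA) Ii Ij.
have yij : y i < y j.
  by apply: lt_le_trans (step _ ia) (mono _ _ _); rewrite ij leqW.
have := range i (leqW ia); have := range j.+1 ja; have := step _ ja.
move=> ? /andP[_ ?] /andP[? _].
have : y j - y i = 0 by apply: int_eq0 => //; apply/andP; split; lra.
by lra.
Qed.

Lemma grid_tiling : tiling a (grid_tile Q c).
Proof.
split.
- by move=> n x y [_ /andP[]].
- exact: grid_tile0.
- exact: grid_tile_cover.
- exact: grid_tile_right.
- exact: grid_tile_left.
- exact: grid_tile_disjoint.
- exact: grid_tile_parent.
- exact: grid_tile_card.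
Qed.

(** Positive level is essential: at level 0 consecutive tiles both project to the whole circle. *)
Lemma grid_tile_adjacent n x y z : grid_tile Q c n.+1 x y ->
  grid_tile Q c n.+1 y z ->
  adjacent_intervals (@circle_pi R @` `[x, y]) (@circle_pi R @` `[y, z]).
Proof.
move=> G1 G2; split; last first.
  exists (circle_pi y); split.
    exact: interval_right_end (grid_tile_interval G1).
  exact: interval_left_end (grid_tile_interval G2).
move=> E; have I2 := grid_tile_interval G2; rewrite -E in I2.
have [QA /andP[xy _] _] := G1; have yx1 := grid_tile_length G1.
have [yZ _] := interval_unique (grid_atom_proper QA) (grid_tile_interval G1) I2.
have : y - x = 0 by apply: int_eq0 => //; apply/andP; split; lra.
by lra.
Qed.

(* At level 0 both sides have length 1; above it consecutive tiles project to
   adjacent atoms. *)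
Lemma grid_comparable (sigma : R) (f : R -> R) : 1 <= sigma ->
  (forall x, f (x + 1) = f x + 1) ->
  (forall n x y u v, let A := @circle_pi R @` `[x, y] in
     let B := @circle_pi R @` `[u, v] in
     interval_from_to A x y -> interval_from_to B u v ->
     Q n A -> Q n B -> adjacent_intervals A B ->
     f y - f x <= sigma * (f v - f u)) ->
  comparable_tiles (grid_tile Q c) sigma f.
Proof.
move=> s1 f1 H [|n] x y z G1 G2.
  by rewrite (grid_tile0 G2) (grid_tile0 G1) !f1; lra.
have I1 := grid_tile_interval G1; have I2 := grid_tile_interval G2.
have [Q1 _ _] := G1; have [Q2 _ _] := G2.
have [ne [p [p1 p2]]] := grid_tile_adjacent G1 G2.
split; last exact: (H _ _ _ _ _ I1 I2 Q1 Q2 (grid_tile_adjacent G1 G2)).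
apply: (H _ _ _ _ _ I2 I1 Q2 Q1); split; first exact/nesym.
by exists p.
Qed.

End grid.

(** * Lifts of circle homeomorphisms *)

Section degree1.
Context (R : realType).
Implicit Types (f M F : R -> R) (x y w c : R).

(** Preimages of [M x - e] and [M x + e] bound a neighbourhood of [x] that [M] maps within [e] of
    [M x]. *)
Lemma increasing_surj_continuous M : {homo M : x y / x < y} ->
  (forall w, exists x, M x = w) -> continuous M.
Proof.
move=> Mlt Msurj x; apply/cvgrPdist_lt => e e0.
have Mle : {mono M : x y / x <= y} by apply: le_mono.
have [u Mu] := Msurj (M x - e); have [v Mv] := Msurj (M x + e).
have ux : u < x by rewrite -(leW_mono Mle) Mu; lra.
have xv : x < v by rewrite -(leW_mono Mle) Mv; lra.
have : \forall s \near x, s \in `]u, v[.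
  by apply: near_in_itvoo; rewrite in_itv /= ux.
apply: filterS => s; rewrite in_itv /= => /andP[/Mlt + /Mlt].
rewrite Mu Mv => ? ?.
by rewrite ltr_norml; apply/andP; split; lra.
Qed.

Lemma degree1_int f x z : (forall x, f (x + 1) = f x + 1) -> z \is a Num.int ->
  f (x + z) = f x + z.
Proof.
move=> f1 /intrP[k ->]; case: k => n; first exact: degree1_nat.
rewrite NegzE intrN; set m := (_%:~R : R).
by have := degree1_nat (x - m) n.+1 f1; rewrite -/m subrK => ->; rewrite addrK.
Qed.

(** Set the value [c] at 0, which the open interval misses, then extend by applying the result to
    the fractional part and adding the integer part. *)
Lemma degree1_extension c F :
  (forall x, 0 < x < 1 -> c < F x < c + 1) ->
  (forall x y, 0 < x -> x < y -> y < 1 -> F x < F y) ->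
  (forall w, c < w < c + 1 -> exists2 x, 0 < x < 1 & F x = w) ->
  exists M, [/\ {homo M : x y / x < y}, forall x, M (x + 1) = M x + 1,
    forall w, exists x, M x = w, M 0 = c & forall x, 0 < x < 1 -> M x = F x].
Proof.
move=> Frange Flt Fsurj.
pose V x := if x == 0 then c else F x.
have Vrange x : 0 <= x < 1 -> c <= V x < c + 1.
  rewrite /V; have [->|x0] := eqVneq x 0; first by rewrite lexx ltrDl ltr01.
  move=> /andP[x0' x1]; have /Frange/andP[? ->] : 0 < x < 1.
    by rewrite lt_neqAle eq_sym x0 x0'.
  by rewrite ltW.
have Vlt x y : 0 <= x -> x < y -> y < 1 -> V x < V y.
  move=> x0 xy y1; have y0 : 0 < y := le_lt_trans x0 xy.
  rewrite /V (gt_eqF y0); have [_|xn0] := eqVneq x 0.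
    by have /Frange/andP[-> _] : 0 < y < 1 by rewrite y0 y1.
  by apply: Flt; rewrite // lt_neqAle eq_sym xn0.
pose fl x : R := (Num.floor x)%:~R.
have flP x : 0 <= x - fl x < 1.
  have := floor_itv x; rewrite intrD -/(fl x) => /andP[? ?].
  by apply/andP; split; lra.
have flE x : 0 <= x < 1 -> fl x = 0.
  move=> x01; rewrite /fl (_ : Num.floor x = 0) //; apply: floor_def.
  by rewrite add0r mulr0z mulr1z.
have flD x z : z \is a Num.int -> fl (x + z) = fl x + z.
  by move=> zZ; rewrite /fl floorDrz // intrD (floorK zZ).
have fl_le x y : x <= y -> fl x <= fl y.
  by move=> ?; rewrite ler_int; exact: le_floor.
pose M x := V (x - fl x) + fl x.
exists M; split.
- move=> x y xy; rewrite /M.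
  have /andP[x0 x1] := flP x; have /andP[y0 y1] := flP y.
  have := fl_le _ _ (ltW xy); rewrite le_eqVlt => /predU1P[E|lt_fl].
    by rewrite -E in y0 y1 *; rewrite ltrD2r; apply: Vlt => //; lra.
  have /andP[_ Vx] := Vrange _ (flP x); have /andP[Vy _] := Vrange _ (flP y).
  (* The values of [V] stay within [[c, c + 1[], so a jump of the integer part by 1 outweighs any
     drop of [V]. *)
  suff : fl x + 1 <= fl y by lra.
  by move: lt_fl; rewrite /fl ltr_int -lezD1 -(ler_int R) intrD mulr1z.
- move=> x; rewrite /M flD ?rpred1 //.
  by have -> : x + 1 - (fl x + 1) = x - fl x; [lra|rewrite addrA].
- move=> w; have [z zZ /andP[h1 h2]] := int_shift c w.
  have [x x01 Vx] : exists2 x, 0 <= x < 1 & V x = w + z.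
    have [E|ne] := eqVneq (w + z) c.
      by exists 0; rewrite ?lexx ?ltr01 // /V eqxx E.
    have [|x /andP[x0 x1] Fx] := Fsurj (w + z).
      by rewrite h2 lt_neqAle eq_sym ne h1.
    by exists x; rewrite ?(ltW x0) ?x1 // /V gt_eqF.
  exists (x - z); rewrite /M flD ?rpredN // flE // add0r opprK subrK Vx.
  by rewrite addrK.
- by rewrite /M flE ?lexx ?ltr01 // subrr /V eqxx addr0.
- move=> x /andP[x0 x1]; rewrite /M flE ?(ltW x0) // subr0 addr0 /V.
  by rewrite gt_eqF.
Qed.

End degree1.

Section lift.
Context (R : realType) (h : circle R -> circle R).
Implicit Types (x y w c : R).

(** Openness in the quotient is openness of the preimage, here the union of the integer translates
    of [U]. *)
Lemma circle_pi_open (U : set R) : open U -> open (@circle_pi R @` U).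
Proof.
move=> oU.
have -> : open (@circle_pi R @` U) =
    open (@circle_pi R @^-1` (@circle_pi R @` U)) by [].
have -> : @circle_pi R @^-1` (@circle_pi R @` U) =
    \bigcup_(z in [set z | z \is a Num.int]) ((fun x => x + z) @^-1` U).
  apply/seteqP; split=> [x [u Uu /circle_piP uxZ]|x [z zZ Ux]].
    by exists (u - x) => //=; rewrite addrC subrK.
  by exists (x + z) => //; exact: circle_piDint.
apply: bigcup_open => z _; apply: open_comp oU => x _.
by apply: cvgD; [exact: cvg_id|exact: cvg_cst].
Qed.

(* On [0 < x < 1] the map [h \o circle_pi] avoids [h (circle_pi 0)], so it
   lifts through the chart [`]c, c + 1[]; the lift is continuous and injective,
   hence monotone. *)
Lemma circle_homeomorphism_lift : circle_homeomorphism h -> exists H M : R -> R,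
  [/\ is_lift h H, {homo M : x y / x < y}, forall x, M (x + 1) = M x + 1,
    forall w, exists x, M x = w & H = M \/ exists d, H = fun x => d - M x].
Proof.
move=> [g [hK gK hc gc]].
have hinj : injective h := can_inj hK.
have [c pc] := circle_pi_ex (h (circle_pi 0)).
have /choice[V VP] x : exists v,
    c <= v < c + 1 /\ circle_pi v = h (circle_pi x).
  have [v pv] := circle_pi_ex (h (circle_pi x)).
  have [z zZ cv] := int_shift c v.
  by exists (v + z); rewrite circle_piDint.
have chart v w : c <= v < c + 1 -> c <= w < c + 1 ->
    circle_pi v = circle_pi w -> v = w.
  move=> /andP[? ?] /andP[? ?] /circle_piP vwZ.
  have : v - w = 0 by apply: int_eq0 => //; apply/andP; split; lra.
  by lra.
have Vrange x : 0 < x < 1 -> c < V x < c + 1.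
  move=> /andP[x0 x1]; have [/andP[cV ->] pV] := VP x.
  rewrite lt_neqAle cV !andbT; apply/eqP => E; move: pV; rewrite -E pc.
  move=> /hinj/circle_piP; rewrite add0r rpredN => xZ.
  have : x = 0 by apply: int_eq0 => //; apply/andP; split; lra.
  by lra.
have Vinj x y : 0 < x < 1 -> 0 < y < 1 -> V x = V y -> x = y.
  move=> /andP[? ?] /andP[? ?] E; have [_ px] := VP x; have [_ py] := VP y.
  move: px; rewrite E py => /hinj/circle_piP yxZ.
  have : y - x = 0 by apply: int_eq0 => //; apply/andP; split; lra.
  by lra.
have Vsurj w : c < w < c + 1 -> exists2 x, 0 < x < 1 & V x = w.
  move=> /andP[cw wc]; have [x px] := circle_pi_ex (g (circle_pi w)).
  have [z zZ] := int_shift 0 x; rewrite -(circle_piDint _ zZ) in px.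
  move: (x + z) px => {z zZ}x px /andP[x0 x1].
  have [Vr pV] := VP x; rewrite px gK in pV.
  have VE : V x = w by apply: chart => //; rewrite ltW.
  exists x => //; rewrite -[1]add0r x1 andbT lt_neqAle x0 andbT.
  apply/eqP => E; suff : c = w by lra.
  by apply: chart; rewrite ?lexx ?ltrDl ?ltr01 ?(ltW cw) // pc E px gK.
have Vcont : {within [set` `]0, 1[%R], continuous V}.
  apply/continuous_in_subspaceT => x; rewrite inE /= in_itv /= => x01.
  apply/cvgrPdist_lt => e e0.
  have /andP[cV Vc] := Vrange _ x01.
  (* The interval around [V x] is clipped to the chart []c, c + 1[], where a point of the circle has
     only one lift. *)
  pose l := Num.max c (V x - e); pose r := Num.min (c + 1) (V x + e).
  have : nbhs x ((h \o @circle_pi R) @^-1` (@circle_pi R @` `]l, r[)).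
    have hpc : {for x, continuous (h \o @circle_pi R)}.
      by apply: continuous_comp; [exact: circle_pi_continuous|exact: hc].
    apply: hpc; apply: open_nbhs_nbhs; split.
      by apply: circle_pi_open; exact: interval_open.
    exists (V x); last by have [] := VP x.
    rewrite /= in_itv /= /l /r gt_max lt_min cV Vc /=.
    by apply/andP; split; lra.
  apply: filterS => y [u]; rewrite /= in_itv /= gt_max lt_min.
  move=> /andP[/andP[cu eu] /andP[uc ue]] pu.
  have [Vr pV] := VP y.
  have -> : V y = u by apply: chart => //; [rewrite ltW|rewrite pV pu].
  by rewrite ltr_norml; apply/andP; split; lra.
(* Serves both orientations, with [s = 1] and [s = -1]: agreement on [[0, 1[] propagates by integer
   translations. *)
have liftP (H : R -> R) (s : R) : (forall x z, z \is a Num.int ->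
      H (x + z) = H x + s * z) -> s \is a Num.int ->
    circle_pi (H 0) = h (circle_pi 0) ->
    (forall x, 0 < x < 1 -> H x = V x) ->
    forall x, circle_pi (H x) = h (circle_pi x).
  move=> Hz sZ H0 HV x; have [z zZ] := int_shift 0 x.
  rewrite -(circle_piDint x zZ) add0r => /andP[x0 x1].
  have -> : circle_pi (H x) = circle_pi (H (x + z)).
    by rewrite Hz // circle_piDint // rpredM.
  move: x0; rewrite le_eqVlt => /predU1P[<- //|x0].
  by rewrite HV ?x0 //; have [] := VP (x + z).
have Vinj' : {in `]0, 1[%R &, injective V}.
  by move=> x y; rewrite !in_itv /=; exact: Vinj.
have [Vlt|Vlt] := itv_continuous_inj_mono Vcont Vinj'.
- have [|M [Mlt M1 Msurj M0 MV]] := degree1_extension Vrange _ Vsurj.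
    by move=> x y x0 xy y1; apply: Vlt; rewrite ?in_itv /= ?x0 ?y1 //=; lra.
  exists M, M; split=> //; last by left.
  split; first exact: increasing_surj_continuous.
  apply: (liftP M 1) => //; last by rewrite M0.
  by move=> x z zZ; rewrite mul1r degree1_int.
(* In the decreasing case, reflecting []c, c + 1[] about its midpoint makes [V] increasing; the lift
   is the reflection of the extension. *)
- have [||| M [Mlt M1 Msurj M0 MV]] :=
      @degree1_extension R c (fun x => c + c + 1 - V x).
  + by move=> x /Vrange/andP[? ?]; apply/andP; split; lra.
  + move=> x y x0 xy y1; suff : V y < V x by lra.
    by apply: Vlt; rewrite ?in_itv /= ?x0 ?y1 //=; lra.
  + move=> w /andP[? ?]; have [|x x01 Vx] := Vsurj (c + c + 1 - w).
      by apply/andP; split; lra.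
    by exists x => //; rewrite Vx; lra.
  exists (fun x => c + c + 1 - M x), M; split=> //; last first.
    by right; exists (c + c + 1).
  split.
    move=> x; apply: cvgB; first exact: cvg_cst.
    exact: increasing_surj_continuous.
  apply: (liftP _ (-1)).
  + by move=> x z zZ; rewrite degree1_int //; lra.
  + by rewrite rpredN rpred1.
  + by rewrite M0 -pc addrAC addrK circle_piDint ?rpred1.
  + by move=> x x01; rewrite MV //; lra.
Qed.

(** The image of [A] is the projection of [[M x, M y]] or of its reflection [[d - M y, d - M x]];
    degree 1 keeps the length at most 1. *)
Lemma lift_interval_length (H M : R -> R) (A : set (circle R)) x y :
  is_lift h H -> {homo M : x y / x < y} -> (forall x, M (x + 1) = M x + 1) ->
  (forall w, exists x, M x = w) -> H = M \/ (exists d, H = fun x => d - M x) ->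
  interval_from_to A x y -> interval_length (h @` A) = M y - M x.
Proof.
move=> [_ Hh] Mlt M1 Msurj HM [/andP[xy yx1] ->].
have Mle : {mono M : x y / x <= y} by apply: le_mono.
have Mxy : M x < M y <= M x + 1 by rewrite Mlt // -M1 Mle.
have hE : h \o @circle_pi R = @circle_pi R \o H.
  by apply/funext => s; rewrite /= Hh.
rewrite image_comp hE -image_comp; case: HM => [->|[d ->]].
- apply: interval_lengthE; split=> //; congr image; apply/seteqP.
  split=> [_ [s /=] + <-|w /=]; rewrite !in_itv /=; first by rewrite !Mle.
  by have [s <-] := Msurj w; rewrite !Mle => ?; exists s.
- have -> : M y - M x = (d - M x) - (d - M y) by lra.
  apply: interval_lengthE; split.
    by apply/andP; case/andP: Mxy; split; lra.
  congr image; apply/seteqP.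
  split=> [_ [s /=] + <-|w /=]; rewrite !in_itv /=.
    by rewrite !lerD2l !lerN2 !Mle andbC.
  have [s Ms] := Msurj (d - w); have -> : w = d - M s by rewrite Ms; lra.
  by rewrite !lerD2l !lerN2 !Mle andbC => ?; exists s.
Qed.

End lift.

(** * The constant [K] and the distortion of a lifted homeomorphism *)

Theorem proposition5p1 (R : realType) (a : nat) (rho lambda : R)
    (ha : (2 <= a)%N) (hrho : 1 < rho) (hlambda : 0 < lambda) :
  exists K : R, 1 < K /\
    forall (Q : nat -> set (set (circle R))) (h : circle R -> circle R),
      fine_grid a rho Q ->
      circle_homeomorphism h ->
      (forall (n : nat) (A B : set (circle R)), Q n A -> Q n B ->
         adjacent_intervals A B ->
         `| interval_length A / interval_length B
            - interval_length (h @` A) / interval_length (h @` B) |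
           <= lambda) ->
      quasisymmetric K h.
Proof.
have a0 : (0 < a)%N by apply: leq_trans ha.
have q1 : 1 < 1 + rho^-1 by rewrite ltrDl invr_gt0; lra.
(* [k] comes from [rho] alone, so [K] is fixed by [a], [rho] and [lambda] before any grid or
   homeomorphism appears. *)
have [k hk] := expr_unbounded (3 * rho) q1.
pose sigma := rho + lambda.
have s1 : 1 <= sigma by rewrite /sigma; lra.
set K := (7 + 2 * sigma) * (a%:R * sigma ^+ a) ^+ k.+1.
have K1 : 1 < K.
  apply: (@lt_le_trans _ _ (7 + 2 * sigma)); first lra.
  rewrite ler_peMr ?exprn_ege1 ?mulr_ege1 ?exprn_ege1 ?ler1n //; lra.
exists K; split=> // Q h gQ hh hQ.
have [H [M [Hlift Mlt M1 Msurj HM]]] := circle_homeomorphism_lift hh.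
have [_ _ _ [_ rhoQ]] := gQ.
have ratio n A B x y u v : interval_from_to A x y -> interval_from_to B u v ->
    Q n A -> Q n B -> adjacent_intervals A B ->
    y - x <= rho * (v - u) /\ M y - M x <= sigma * (M v - M u).
  move=> Ax Bu QA QB AB.
  have := rhoQ n A B QA QB AB; have := hQ n A B QA QB AB.
  rewrite !(lift_interval_length Hlift Mlt M1 Msurj HM Ax).
  rewrite !(lift_interval_length Hlift Mlt M1 Msurj HM Bu).
  rewrite (interval_lengthE Ax) (interval_lengthE Bu).
  have /andP[xy _] := interval_from_to_lt Ax.
  have /andP[uv _] := interval_from_to_lt Bu.
  have Muv : 0 < M v - M u by rewrite subr_gt0 Mlt.
  move=> /ler_normlP[le1 _] /andP[+ _].
  rewrite mulrC ler_pdivrMr ?(lt_trans ltr01) // mulrC => le2; split=> //.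
  rewrite -ler_pdivrMr //.
  have : (y - x) / (v - u) <= rho by rewrite ler_pdivrMr ?subr_gt0.
  by rewrite /sigma; lra.
(* The circle of level 0 is cut at the left end [c] of a lifted atom of level 1. *)
have [A [c [d [QA [cd AE] _]]]] := atom_cover_lift (grid_partition gQ 1) 0.
have hc : exists z, grid_tile Q c 1 c z by exists d; split=> //; rewrite -AE.
have tG := grid_tiling gQ hc.
have crho : comparable_tiles (grid_tile Q c) rho id.
  apply: (grid_comparable gQ) => //; first exact: ltW.
  move=> n x y u v ? ? Ax Bu QA' QB AB.
  by have [] := ratio _ _ _ _ _ _ _ Ax Bu QA' QB AB.
have csigma : comparable_tiles (grid_tile Q c) sigma M.
  apply: (grid_comparable gQ) => //.
  move=> n x y u v ? ? Ax Bu QA' QB AB.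
  by have [] := ratio _ _ _ _ _ _ _ Ax Bu QA' QB AB.
have Mle : {homo M : x y / x <= y} by apply: ltW_homo.
split; first exact: ltW.
exists H; split=> // x t t0.
have [le1 le2] := tile_quasisymmetric tG x a0 hrho s1 Mle M1 crho csigma hk t0.
have p0 : 0 < M (x + t) - M x by rewrite subr_gt0 Mlt ?ltrDl.
have q0 : 0 < M x - M (x - t) by rewrite subr_gt0 Mlt // gtrBl.
(* A possible reversal of orientation disappears under absolute values. *)
have HE y z : `|H y - H z| = `|M y - M z|.
  case: HM => [->//|[e ->]].
  by rewrite opprD opprK addrACA subrr add0r addrC distrC.
rewrite !HE !gtr0_norm //; apply/andP; split; last by rewrite ler_pdivrMr.
rewrite ler_pdivlMr // mulrC ler_pdivrMr 1?mulrC //; lra.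
Qed.
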